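(* Let $S$ and $T$ be monads on $\mathbf{Set}$ with corresponding algebraic theories $\mathbb{S}$ and $\mathbb{T}$ (i.e. $S$ and $T$ are the free model monads of $\mathbb{S}$ and $\mathbb{T}$), each of which has a signature consisting of exactly one constant and one binary operation. Suppose that in each of the two theories the constant acts as a (two-sided) unit for the binary operation, and that, for each theory $\mathbb{X} \in \{\mathbb{S},\mathbb{T}\}$: (1) for any two $\mathbb{X}$-terms $r_1,r_2$: if $r_1$ contains no variables and $r_1 =_{\mathbb{X}} r_2$, then $r_2$ contains no variables; (2) for any $\mathbb{X}$-term $r$ and variable $x$: if $r =_{\mathbb{X}} x$, then all variables of $r$ lie in $\{x\}$. Then there exists at most one distributive law $ST \Rightarrow TS$.
   Context: An algebraic theory $\mathbb{T}$ consists of a signature of finitary operation symbols and a set of pairs of terms (axioms), over an infinite supply of variables; a constant in a signature is a 0-ary operation symbol. $t_1 =_{\mathbb{T}} t_2$ means the terms are provably equal from the axioms in (standard) equational logic. The free model monad of $\mathbb{T}$ is the monad on $\mathbf{Set}$ induced by the free/forgetful adjunction between $\mathbf{Set}$ and the category of $\mathbb{T}$-algebras: it sends a set $A$ to the set of $\mathbb{T}$-terms with variables in $A$ modulo provable equality, with unit given by variables and multiplication given by substitution. A monad corresponds to (is presented by) $\mathbb{T}$ if it is a free model monad induced by $\mathbb{T}$. For monads $(S,\eta^S,\mu^S)$, $(T,\eta^T,\mu^T)$, a distributive law $\lambda: ST \Rightarrow TS$ is a natural transformation with $\lambda\cdot\eta^S T = T\eta^S$, $\lambda\cdot S\eta^T=\eta^T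 S$, $\lambda\cdot\mu^S T = T\mu^S\cdot\lambda S\cdot S\lambda$ and $\lambda\cdot S\mu^T=\mu^T S\cdot T\lambda\cdot\lambda T$. *)

(* Defs.v *)
From HB Require Import structures.
From mathcomp Require Import all_boot generic_quotient boolp.

Set Implicit Arguments.
Unset Strict Implicit.
Unset Printing Implicit Defensive.

Local Open Scope quotient_scope.

Record monad := Monad {
  mobj :> Type -> Type;
  fmap : forall A B : Type, (A -> B) -> mobj A -> mobj B;
  ret : forall A : Type, A -> mobj A;
  join : forall A : Type, mobj (mobj A) -> mobj A;
  fmap_id : forall (A : Type) (m : mobj A), fmap id m = m;
  fmap_comp : forall (A B C : Type) (g : B -> C) (f : A -> B) (m : mobj A),
    fmap (g \o f) m = fmap g (fmap f m);
  ret_nat : forall (A B : Type) (f : A -> B) (a : A),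
    fmap f (ret a) = ret (f a);
  join_nat : forall (A B : Type) (f : A -> B) (m : mobj (mobj A)),
    fmap f (join m) = join (fmap (fmap f) m);
  join_ret : forall (A : Type) (m : mobj A), join (ret m) = m;
  join_fmap_ret : forall (A : Type) (m : mobj A),
    join (fmap (@ret A) m) = m;
  join_join : forall (A : Type) (m : mobj (mobj (mobj A))),
    join (join m) = join (fmap (@join A) m)
}.

Arguments ret M {A} a : rename.
Arguments join M {A} m : rename.

Record monad_iso (M N : monad) (theta : forall A : Type, M A -> N A) : Prop :=
  MonadIso {
    iso_bij : forall A : Type, bijective (@theta A);
    iso_nat : forall (A B : Type) (f : A -> B) (m : M A),
      theta B (fmap f m) = fmap f (theta A m);
    iso_ret : forall (A : Type) (a : A), theta A (ret M a) = ret N a;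
    iso_join : forall (A : Type) (m : M (M A)),
      theta A (join M m) = join N (fmap (@theta A) (theta (M A) m))
  }.

Record distributive_law (S T : monad)
    (lam : forall A : Type, S (T A) -> T (S A)) : Prop := DistributiveLaw {
  dist_nat : forall (A B : Type) (f : A -> B) (m : S (T A)),
    lam B (fmap (fmap f) m) = fmap (fmap f) (lam A m);
  dist_retl : forall (A : Type) (t : T A),
    lam A (ret S t) = fmap (ret S) t;
  dist_retr : forall (A : Type) (s : S A),
    lam A (fmap (ret T) s) = ret T s;
  dist_joinl : forall (A : Type) (m : S (S (T A))),
    lam A (join S m) = fmap (join S) (lam (S A) (fmap (@lam A) m));
  dist_joinr : forall (A : Type) (m : S (T (T A))),
    lam A (fmap (join T) m) = join T (fmap (@lam A) (lam (T A) m))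
}.

Record signature := Signature {
  op :> Type;
  arity : op -> nat
}.

Inductive term (Sig : signature) (A : Type) : Type :=
  | Var (a : A)
  | App (o : Sig) (args : 'I_(arity o) -> term Sig A).

Arguments Var {Sig A} a.
Arguments App {Sig A} o args.

HB.instance Definition _ (Sig : signature) (A : Type) :=
  gen_eqMixin (term Sig A).
HB.instance Definition _ (Sig : signature) (A : Type) :=
  gen_choiceMixin (term Sig A).

Fixpoint subst (Sig : signature) (A B : Type) (f : A -> term Sig B)
    (t : term Sig A) : term Sig B :=
  match t with
  | Var a => f a
  | App o args => App o (fun i => subst f (args i))
  end.

Fixpoint occurs (Sig : signature) (A : Type) (x : A) (t : term Sig A) : Prop :=
  match t with
  | Var a => a = x
  | App o args => exists i, occurs x (args i)
  end.

(* The variables available in axioms are the natural numbers. *)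
Record theory := Theory {
  sig :> signature;
  axiom : term sig nat -> term sig nat -> Prop
}.

Inductive provable (X : theory) :
    forall A : Type, term X A -> term X A -> Prop :=
  | prov_axiom (t u : term X nat) : axiom t u -> provable t u
  | prov_refl (A : Type) (t : term X A) : provable t t
  | prov_sym (A : Type) (t u : term X A) : provable t u -> provable u t
  | prov_trans (A : Type) (t u v : term X A) :
      provable t u -> provable u v -> provable t v
  | prov_cong (A : Type) (o : X) (t u : 'I_(arity o) -> term X A) :
      (forall i, provable (t i) (u i)) -> provable (App o t) (App o u)
  | prov_subst (A B : Type) (f : A -> term X B) (t u : term X A) :
      provable t u -> provable (subst f t) (subst f u).

Section FreeModel.
Variable X : theory.

Definition provableb (A : Type) (t u : term X A) : bool := `[< provable t u >].

Lemma provableb_equiv (A : Type) : equiv_class_of (@provableb A).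
Proof.
split=> [t|t u|u t v].
- by apply/asboolP; exact: prov_refl.
- by apply/asboolP/asboolP; exact: prov_sym.
- by move=> /asboolP tu /asboolP uv; apply/asboolP; exact: prov_trans tu uv.
Qed.

Canonical provable_equiv (A : Type) : equiv_rel (term X A) :=
  EquivRelPack (provableb_equiv A).

Definition free_model (A : Type) : Type := {eq_quot provable_equiv A}.

Definition cls (A : Type) (t : term X A) : free_model A :=
  \pi_({eq_quot provable_equiv A}) t.

Definition rep (A : Type) (q : free_model A) : term X A :=
  repr (q : {eq_quot provable_equiv A}).

Lemma repK (A : Type) (q : free_model A) : cls (rep q) = q.
Proof. exact: reprK. Qed.

Lemma cls_eq (A : Type) (t u : term X A) : cls t = cls u <-> provable t u.
Proof.
split=> [/eqquotP|tu]; first by move=> /asboolP.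
by apply/eqquotP/asboolP.
Qed.

Lemma rep_cls (A : Type) (t : term X A) : provable (rep (cls t)) t.
Proof. by apply/cls_eq; exact: repK. Qed.

Definition free_fmap (A B : Type) (f : A -> B) (q : free_model A) :
    free_model B :=
  cls (subst (fun a => Var (f a)) (rep q)).

Definition free_ret (A : Type) (a : A) : free_model A := cls (Var a).

Definition free_join (A : Type) (q : free_model (free_model A)) :
    free_model A :=
  cls (subst (@rep A) (rep q)).

Lemma subst_Var (A : Type) (t : term X A) : subst Var t = t.
Proof. by elim: t => //= o args IH; congr App; apply: funext. Qed.

Lemma subst_subst (A B C : Type) (g : B -> term X C) (f : A -> term X B)
    (t : term X A) :
  subst g (subst f t) = subst (fun a => subst g (f a)) t.
Proof. by elim: t => //= o args IH; congr App; apply: funext. Qed.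

Lemma provable_substl (A B : Type) (f g : A -> term X B) (t : term X A) :
  (forall a, provable (f a) (g a)) -> provable (subst f t) (subst g t).
Proof. by move=> fg; elim: t => //= o args IH; exact: prov_cong. Qed.

Lemma free_fmap_cls (A B : Type) (f : A -> B) (t : term X A) :
  free_fmap f (cls t) = cls (subst (fun a => Var (f a)) t).
Proof. by apply/cls_eq; apply: prov_subst; exact: rep_cls. Qed.

Lemma free_join_cls (A : Type) (t : term X (free_model A)) :
  free_join (cls t) = cls (subst (@rep A) t).
Proof. by apply/cls_eq; apply: prov_subst; exact: rep_cls. Qed.

Lemma free_fmap_id (A : Type) (q : free_model A) : free_fmap id q = q.
Proof. by rewrite /free_fmap subst_Var repK. Qed.

Lemma free_fmap_comp (A B C : Type) (g : B -> C) (f : A -> B)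
    (q : free_model A) :
  free_fmap (g \o f) q = free_fmap g (free_fmap f q).
Proof.
by rewrite -(repK q) !free_fmap_cls subst_subst.
Qed.

Lemma free_ret_nat (A B : Type) (f : A -> B) (a : A) :
  free_fmap f (free_ret a) = free_ret (f a).
Proof. exact: free_fmap_cls. Qed.

Lemma free_join_nat (A B : Type) (f : A -> B)
    (q : free_model (free_model A)) :
  free_fmap f (free_join q) = free_join (free_fmap (free_fmap f) q).
Proof.
rewrite -(repK q) free_join_cls !free_fmap_cls free_join_cls !subst_subst.
apply/cls_eq; apply: provable_substl => p /=.
by apply: prov_sym; exact: rep_cls.
Qed.

Lemma free_join_ret (A : Type) (q : free_model A) :
  free_join (free_ret q) = q.
Proof. by rewrite free_join_cls /= repK. Qed.

Lemma free_join_fmap_ret (A : Type) (q : free_model A) :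
  free_join (free_fmap (@free_ret A) q) = q.
Proof.
rewrite -{2}(repK q) free_join_cls subst_subst -{2}(subst_Var (rep q)).
by apply/cls_eq; apply: provable_substl => a; exact: rep_cls.
Qed.

Lemma free_join_join (A : Type) (q : free_model (free_model (free_model A))) :
  free_join (free_join q) = free_join (free_fmap (@free_join A) q).
Proof.
rewrite -(repK q) free_fmap_cls !free_join_cls !subst_subst.
apply/cls_eq; apply: provable_substl => p /=.
by apply: prov_sym; exact: rep_cls.
Qed.

Definition free_model_monad : monad :=
  Monad free_fmap_id free_fmap_comp free_ret_nat free_join_nat free_join_ret
    free_join_fmap_ret free_join_join.

End FreeModel.

(* Free models are determined only up to isomorphism, hence so is the monad. *)
Definition corresponds_to (M : monad) (X : theory) : Prop :=
  exists theta : forall A : Type, M A -> free_model_monad X A, monad_iso theta.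

Record const_bin_signature (Sig : signature) := ConstBinSignature {
  const_op : Sig;
  bin_op : Sig;
  arity_const : arity const_op = 0;
  arity_bin : arity bin_op = 2;
  const_or_bin : forall o : Sig, o = const_op \/ o = bin_op
}.

Definition const_term (Sig : signature) (cb : const_bin_signature Sig)
    (A : Type) : term Sig A :=
  App (const_op cb) (fun i => tnth [tuple] (cast_ord (arity_const cb) i)).

Definition bin_term (Sig : signature) (cb : const_bin_signature Sig)
    (A : Type) (t u : term Sig A) : term Sig A :=
  App (bin_op cb) (fun i => tnth [tuple t; u] (cast_ord (arity_bin cb) i)).

Definition const_is_unit (X : theory) (cb : const_bin_signature X) : Prop :=
  forall t : term X nat,
    provable (bin_term cb (const_term cb nat) t) t /\
    provable (bin_term cb t (const_term cb nat)) t.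

Definition no_variables (Sig : signature) (t : term Sig nat) : Prop :=
  forall x : nat, ~ occurs x t.

Definition closed_stable (X : theory) : Prop :=
  forall r1 r2 : term X nat,
    no_variables r1 -> provable r1 r2 -> no_variables r2.

Definition variable_stable (X : theory) : Prop :=
  forall (r : term X nat) (x : nat),
    provable r (Var x) -> forall y : nat, occurs y r -> y = x.

(* Main.v *)
(* A distributive law [lam] makes [T (S B)] an [S]-algebra, with a product
   [p ** q] and unit [1], and [lam] is recovered from this algebra.  Elements of
   [T (S B)] are [T]-sums of variables [s : S B], so [**] is determined once it
   is known to be bilinear.
   - [0 ** z] becomes [0] at [z = 1]; terms equal to [0] have no variables, so
     [0 ** z] is a closed sum, hence [0].
   - Write [(x + y) ** z] as a [T]-term [W] in variables [s : S {x, y, z}].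
     At [z = 1] it becomes [x + y]; killing [x] or [y] in the latter leaves a
     single variable, so each [s] becomes [x] or [y] at [z = 1].  If [s] becomes
     [x] then [y] does not occur in [s]; setting [y = 0] turns [W] into [x * z]
     and leaves [s] alone, whence [s = x * z].  Thus [W] is obtained from
     [x + y] by substituting [x * z] and [y * z].
   The same applies on the other side, by passing to the opposite of the binary
   operation of [S]. *)
Require Import Defs.
From mathcomp Require Import all_boot.
From mathcomp Require Import boolp.

Set Implicit Arguments.
Unset Strict Implicit.
Unset Printing Implicit Defensive.

(** * Kleisli calculus of a monad *)

Section MonadTheory.
Variable M : monad.
Implicit Types A B C : Type.

Definition bind A B (f : A -> M B) (m : M A) : M B := join M (fmap f m).

Lemma bind_ret A B (f : A -> M B) a : bind f (ret M a) = f a.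
Proof. by rewrite /bind ret_nat join_ret. Qed.

Lemma bind_fmap A B C (f : B -> M C) (g : A -> B) m :
  bind f (fmap g m) = bind (f \o g) m.
Proof. by rewrite /bind fmap_comp. Qed.

Lemma fmap_bind A B C (f : B -> C) (g : A -> M B) m :
  fmap f (bind g m) = bind (fmap f \o g) m.
Proof. by rewrite /bind join_nat fmap_comp. Qed.

Lemma bind_bind A B C (f : B -> M C) (g : A -> M B) m :
  bind f (bind g m) = bind (bind f \o g) m.
Proof. by rewrite /bind join_nat join_join -!fmap_comp. Qed.

Lemma bind_ret_comp A B (f : A -> B) m : bind (ret M \o f) m = fmap f m.
Proof. by rewrite /bind fmap_comp join_fmap_ret. Qed.

Lemma join_bind A (m : M (M A)) : join M m = bind id m.
Proof. by rewrite /bind fmap_id. Qed.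

End MonadTheory.

(** * Terms in one constant and one binary operation *)

Inductive magma_term (A : Type) : Type :=
  | Leaf (a : A)
  | Unit
  | Node (r s : magma_term A).

Arguments Leaf {A} a.
Arguments Unit {A}.

Fixpoint magma_subst A B (f : A -> magma_term B) r :=
  match r with
  | Leaf a => f a
  | Unit => Unit
  | Node r s => Node (magma_subst f r) (magma_subst f s)
  end.

Fixpoint leaf_of A (a : A) r : Prop :=
  match r with
  | Leaf b => b = a
  | Unit => False
  | Node r s => leaf_of a r \/ leaf_of a s
  end.

Fixpoint mirror A (r : magma_term A) :=
  match r with
  | Node r s => Node (mirror s) (mirror r)
  | _ => r
  end.

Lemma leaf_of_subst A B (f : A -> magma_term B) r b :
  leaf_of b (magma_subst f r) <-> exists2 a, leaf_of a r & leaf_of b (f a).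
Proof.
elim: r => [a||r IHr s IHs] /=.
- by split=> [fab|[_ <- //]]; exists a.
- by split=> [|[]].
- split=> [[/IHr|/IHs] [a ra fab]|[a [ra|sa] fab]].
  + by exists a; first left.
  + by exists a; first right.
  + by left; apply/IHr; exists a.
  + by right; apply/IHs; exists a.
Qed.

Lemma mirrorK A : involutive (@mirror A).
Proof. by elim=> //= r -> s ->. Qed.

Lemma leaf_of_mirror A (a : A) r : leaf_of a (mirror r) <-> leaf_of a r.
Proof. by elim: r => //= r IHr s IHs; rewrite IHr IHs; split=> -[]; auto. Qed.

(* By the Yoneda lemma, natural constants and binary operations on the algebras
   of [M] are the elements [u : M void] and [b : M bool]. *)
Section Evaluation.
Variables (M : monad) (u : M void) (b : M bool).
Implicit Types A B C : Type.

Definition unit A : M A := fmap (of_void A) u.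

Definition op A (m n : M A) : M A := bind (fun c => if c then m else n) b.

Fixpoint ev A (r : magma_term A) : M A :=
  match r with
  | Leaf a => ret M a
  | Unit => unit A
  | Node r s => op (ev r) (ev s)
  end.

Lemma fmap_unit A B (f : A -> B) : fmap f (unit A) = unit B.
Proof. by rewrite /unit -fmap_comp; congr fmap; apply: funext => -[]. Qed.

Lemma bind_unit A B (f : A -> M B) : bind f (unit A) = unit B.
Proof.
rewrite /unit bind_fmap -bind_ret_comp /bind; congr (join M (fmap _ _)).
by apply: funext => -[].
Qed.

Lemma bind_op A B (f : A -> M B) m n :
  bind f (op m n) = op (bind f m) (bind f n).
Proof.
by rewrite /op bind_bind /bind; congr (join M (fmap _ _)); apply: funext => -[].
Qed.

Lemma fmap_op A B (f : A -> B) m n :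
  fmap f (op m n) = op (fmap f m) (fmap f n).
Proof. by rewrite -!bind_ret_comp bind_op. Qed.

Lemma join_op A (m n : M (M A)) : join M (op m n) = op (join M m) (join M n).
Proof. by rewrite !join_bind bind_op. Qed.

Lemma ev_subst A B (f : A -> magma_term B) r :
  ev (magma_subst f r) = bind (@ev B \o f) (ev r).
Proof.
by elim: r => [a||r IHr s IHs] /=; rewrite ?bind_ret ?bind_unit ?bind_op ?IHr ?IHs.
Qed.

Lemma eq_bind_ev A B (f g : A -> M B) r :
  (forall a, leaf_of a r -> f a = g a) -> bind f (ev r) = bind g (ev r).
Proof.
elim: r => [a||r IHr s IHs] /= fg; rewrite ?bind_ret ?bind_unit ?bind_op //.
  exact: fg.
by rewrite IHr ?IHs // => a ra; apply: fg; auto.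
Qed.

(** The hypotheses on a theory, restated inside the monad: equality of evaluations stands for
    provable equality, and variables may come from any type. *)
Record unital_presentation : Prop := UnitalPresentation {
  op_unitl : forall A (m : M A), op (unit A) m = m;
  op_unitr : forall A (m : M A), op m (unit A) = m;
  ev_surj : forall A (m : M A), exists r, m = ev r;
  ev_closed : forall A (r s : magma_term A), ev r = ev s ->
    (forall a, ~ leaf_of a r) -> forall a, ~ leaf_of a s;
  ev_var : forall A (r : magma_term A) a, ev r = ret M a ->
    forall a', leaf_of a' r -> a' = a
}.

Hypothesis P : unital_presentation.

Lemma magma_ind A (Q : M A -> Prop) :
  (forall a, Q (ret M a)) -> Q (unit A) ->
  (forall m n, Q m -> Q n -> Q (op m n)) -> forall m, Q m.
Proof. by move=> ? ? ? m; have [r ->] := ev_surj P m; elim: r => /=; auto. Qed.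

(** Choosing representing terms turns a Kleisli map into a syntactic substitution, whose leaves can
    be tracked. *)
Lemma bind_lift A B (f : A -> M B) :
  exists2 g : A -> magma_term B, f = @ev B \o g &
    forall r, bind f (ev r) = ev (magma_subst g r).
Proof.
have [g fg] := choice (fun a => ev_surj P (f a)).
have -> : f = @ev B \o g by exact: funext.
by exists g => // r; rewrite ev_subst.
Qed.

Lemma ret_inj A : injective (@ret M A).
Proof. by move=> a a' e; apply: (ev_var P (r := Leaf a)). Qed.

Lemma ev_no_leaf A (r : magma_term A) :
  (forall a, ~ leaf_of a r) -> ev r = unit A.
Proof.
elim: r => [a|//|r IHr s IHs] /= cl; first by have /(_ erefl) := cl a.
by rewrite IHr ?IHs ?(op_unitl P) // => a ?; apply: (cl a); auto.
Qed.

(** Renaming preserves the presence of variables, so a term whose renaming equals the constant is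
    itself closed, and a closed term collapses by the unit laws. *)
Lemma fmap_eq_unit A B (f : A -> B) m : fmap f m = unit B -> m = unit A.
Proof.
have [r ->] := ev_surj P m.
rewrite -bind_ret_comp -(ev_subst (Leaf \o f)) => fr0.
apply: ev_no_leaf => a ra.
have /= cl := @ev_closed P B Unit _ (esym fr0) (fun _ => id) (f a).
by apply/cl/leaf_of_subst; exists a.
Qed.

(** A term equal to the variable [b0] must contain [b0]: a closed one would contradict [ev_closed].
    Substitution carries this occurrence into a term equal to [b1], so [ev_var] identifies the
    two. *)
Lemma bind_eq_ret A B (f : A -> M B) r a b0 b1 :
  bind f (ev r) = ret M b1 -> leaf_of a r -> f a = ret M b0 -> b0 = b1.
Proof.
have [g -> ->] := bind_lift f => e ra ga.
have sub b' : leaf_of b' (g a) -> leaf_of b' (magma_subst g r).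
  by move=> ?; apply/leaf_of_subst; exists a.
have [b' gab'] : exists b', leaf_of b' (g a).
  apply: contrapT => nl; apply: (ev_closed P (s := Leaf b0) ga _ (a := b0)) => //.
  by move=> b' gb'; apply: nl; exists b'.
by rewrite -(ev_var P ga gab'); apply: (ev_var P e); exact: sub.
Qed.

End Evaluation.

(** * Passing to the opposite operation *)

Lemma op_opposite (M : monad) (b : M bool) A (m n : M A) :
  op (fmap negb b) m n = op b n m.
Proof.
by rewrite /op bind_fmap /bind; congr (join M (fmap _ _)); apply: funext => -[].
Qed.

Lemma ev_opposite (M : monad) u (b : M bool) A (r : magma_term A) :
  ev u (fmap negb b) r = ev u b (mirror r).
Proof. by elim: r => //= r -> s ->; rewrite op_opposite. Qed.

Lemma opposite_presentation (M : monad) u (b : M bool) :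
  unital_presentation u b -> unital_presentation u (fmap negb b).
Proof.
move=> P; split=> [A m|A m|A m|A r s|A r a].
- by rewrite op_opposite (op_unitr P).
- by rewrite op_opposite (op_unitl P).
- by have [r ->] := ev_surj P m; exists (mirror r); rewrite ev_opposite mirrorK.
- rewrite !ev_opposite => e cl a /leaf_of_mirror.
  by apply: (ev_closed P e) => a' /leaf_of_mirror; exact: cl.
- by rewrite ev_opposite => e a' /leaf_of_mirror; exact: (ev_var P e).
Qed.

(** * Presentation of the free model monad of a theory *)

Lemma occurs_rename (Sig : signature) A B (f : A -> B) (t : term Sig A) b :
  occurs b (subst (fun a => Var (f a)) t) <-> exists2 a, occurs a t & f a = b.
Proof.
elim: t => [a|o args IH] /=.
  by split=> [fab|[_ <- //]]; exists a.
split=> [[i /IH [a ia fab]]|[a [i ia] fab]]; first by exists a => //; exists i.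
by exists i; apply/IH; exists a.
Qed.

Section FreeModelPresentation.
Variables (X : theory) (cb : const_bin_signature X).
Hypotheses (unitX : const_is_unit cb) (closedX : closed_stable X)
  (varX : variable_stable X).

Fixpoint term_of A (r : magma_term A) : term X A :=
  match r with
  | Leaf a => Var a
  | Unit => const_term cb A
  | Node r s => bin_term cb (term_of r) (term_of s)
  end.

Lemma const_args_void (i : 'I_(arity (const_op cb))) : False.
Proof. by case: i => m; rewrite (arity_const cb). Qed.

Lemma const_termE A (args : 'I_(arity (const_op cb)) -> term X A) :
  App (const_op cb) args = const_term cb A.
Proof. by congr App; apply: funext => i; have := const_args_void i. Qed.

Lemma bin_args_split (i : 'I_(arity (bin_op cb))) :
  i = cast_ord (esym (arity_bin cb)) ord0 \/
  i = cast_ord (esym (arity_bin cb)) ord_max.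
Proof.
rewrite -(cast_ordK (arity_bin cb) i).
by case: (cast_ord _ i) => -[|[|//]] lt; [left|right]; congr cast_ord; apply: val_inj.
Qed.

Lemma bin_termE A (args : 'I_(arity (bin_op cb)) -> term X A) :
  App (bin_op cb) args =
  bin_term cb (args (cast_ord (esym (arity_bin cb)) ord0))
              (args (cast_ord (esym (arity_bin cb)) ord_max)).
Proof.
by congr App; apply: funext => i; have [->|->] := bin_args_split i;
  rewrite cast_ordKV (tnth_nth (args i)).
Qed.

Lemma subst_const A B (f : A -> term X B) :
  subst f (const_term cb A) = const_term cb B.
Proof. exact: const_termE. Qed.

Lemma subst_bin A B (f : A -> term X B) t t' :
  subst f (bin_term cb t t') = bin_term cb (subst f t) (subst f t').
Proof.
by rewrite /= bin_termE !cast_ordKV !(tnth_nth t).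
Qed.

Lemma occurs_bin A (a : A) t t' :
  occurs a (bin_term cb t t') <-> occurs a t \/ occurs a t'.
Proof.
split=> [[i]|[at_|at_]].
- by have [->|->] := bin_args_split i; rewrite cast_ordKV (tnth_nth t) /=; auto.
- by exists (cast_ord (esym (arity_bin cb)) ord0); rewrite cast_ordKV (tnth_nth t).
- by exists (cast_ord (esym (arity_bin cb)) ord_max); rewrite cast_ordKV (tnth_nth t).
Qed.

Lemma occurs_term_of A (a : A) r : occurs a (term_of r) <-> leaf_of a r.
Proof.
elim: r => [//||r IHr s IHs].
- by split=> // -[i]; have := const_args_void i.
- by rewrite /= -IHr -IHs; exact: occurs_bin.
Qed.

Lemma term_of_surj A (t : term X A) : exists r, t = term_of r.
Proof.
elim: t => [a|o args IH]; first by exists (Leaf a).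
case: (const_or_bin cb o) => eo; subst o.
  by exists Unit; exact: const_termE.
have [r er] := IH (cast_ord (esym (arity_bin cb)) ord0).
have [s es] := IH (cast_ord (esym (arity_bin cb)) ord_max).
by exists (Node r s); rewrite bin_termE er es.
Qed.

Lemma provable_bin A (t t' s s' : term X A) :
  provable t t' -> provable s s' ->
  provable (bin_term cb t s) (bin_term cb t' s').
Proof.
move=> tt' ss'; apply: prov_cong => i.
by have [->|->] := bin_args_split i; rewrite cast_ordKV !(tnth_nth t).
Qed.

Lemma provable_units A (t : term X A) :
  provable (bin_term cb (const_term cb A) t) t /\
  provable (bin_term cb t (const_term cb A)) t.
Proof.
(* The unit laws at a single variable, with [t] substituted for it, carry over from [nat] to [A]. *)
have [l r] := unitX (Var 0).
have := prov_subst (fun=> t) l; have := prov_subst (fun=> t) r.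
by rewrite !subst_bin !subst_const.
Qed.

Lemma provable_closed A (r s : term X A) : provable r s ->
  (forall a, ~ occurs a r) -> forall a, ~ occurs a s.
Proof.
(* Sending every variable to [0] moves the equation to terms over [nat], keeping closed terms closed
   and open terms open. *)
move=> rs cl a sa; have rs0 := prov_subst (fun=> Var 0) rs.
apply: (closedX _ rs0 (x := 0)); last by apply/occurs_rename; exists a.
by move=> x /occurs_rename [a' /cl].
Qed.

Lemma provable_var A (r : term X A) a : provable r (Var a) ->
  forall a', occurs a' r -> a' = a.
Proof.
(* [h] separates [a] from everything else: a variable other than [a] would become [1] in a term
   equal to the variable [0]. *)
move=> ra a' ra'; pose h (c : A) := if `[< c = a >] then 0 else 1.
have r0 : provable (subst (fun c => Var (h c)) r) (Var 0).
  by have := prov_subst (fun c => Var (h c)) ra; rewrite /= {2}/h asboolT.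
have : h a' = 0 by apply: (varX r0); apply/occurs_rename; exists a'.
by rewrite /h; case: asboolP.
Qed.

Definition free_unit : free_model_monad X void := cls (const_term cb void).

Definition free_op : free_model_monad X bool :=
  cls (bin_term cb (Var true) (Var false)).

Lemma free_unitE A : unit free_unit A = cls (const_term cb A).
Proof. by rewrite /unit /= free_fmap_cls subst_const. Qed.

Lemma free_opE A (t s : term X A) :
  op free_op (cls t) (cls s) = cls (bin_term cb t s).
Proof.
rewrite /op /bind /= free_fmap_cls free_join_cls !subst_bin.
by apply/cls_eq/provable_bin; exact: rep_cls.
Qed.

Lemma ev_free A (r : magma_term A) :
  ev free_unit free_op r = cls (term_of r).
Proof.
elim: r => [//||r IHr s IHs] /=; first exact: free_unitE.
by rewrite IHr IHs; exact: free_opE.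
Qed.

Lemma free_presentation : unital_presentation free_unit free_op.
Proof.
split=> [A m|A m|A m|A r s|A r a].
- rewrite -(repK m) free_unitE free_opE; apply/cls_eq.
  by case: (provable_units (rep m)).
- rewrite -(repK m) free_unitE free_opE; apply/cls_eq.
  by case: (provable_units (rep m)).
- by have [r er] := term_of_surj (rep m); exists r; rewrite ev_free -er repK.
- rewrite !ev_free => /cls_eq rs cl a /occurs_term_of.
  by apply: (provable_closed rs) => a' /occurs_term_of; exact: cl.
- by rewrite ev_free => /cls_eq ra a' /occurs_term_of; exact: (provable_var ra).
Qed.

End FreeModelPresentation.

(** * Transport along an isomorphism of monads *)

Section IsoPresentation.
Variables (M N : monad) (theta : forall A : Type, M A -> N A).
Hypothesis iso : monad_iso theta.
Variables (u : M void) (b : M bool).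
Hypothesis P : unital_presentation (theta u) (theta b).

Lemma iso_inj A : injective (@theta A).
Proof. by have [g gK _] := iso_bij iso A; exact: can_inj gK. Qed.

Lemma iso_unit A : theta (unit u A) = unit (theta u) A.
Proof. exact: iso_nat. Qed.

Lemma iso_op A (m n : M A) :
  theta (op b m n) = op (theta b) (theta m) (theta n).
Proof.
rewrite /op /bind (iso_join iso) (iso_nat iso) -fmap_comp.
by congr (join N (fmap _ _)); apply: funext => -[].
Qed.

Lemma iso_ev A (r : magma_term A) :
  theta (ev u b r) = ev (theta u) (theta b) r.
Proof.
elim: r => [a||r IHr s IHs] /=; first exact: iso_ret.
  exact: iso_unit.
by rewrite iso_op IHr IHs.
Qed.

Lemma iso_presentation : unital_presentation u b.
Proof.
split=> [A m|A m|A m|A r s e|A r a e].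
- by apply: iso_inj; rewrite iso_op iso_unit (op_unitl P).
- by apply: iso_inj; rewrite iso_op iso_unit (op_unitr P).
- have [r er] := ev_surj P (theta m); exists r.
  by apply: iso_inj; rewrite iso_ev.
- by apply: (ev_closed P); rewrite -!iso_ev e.
- by apply: (ev_var P); rewrite -iso_ev e (iso_ret iso).
Qed.

End IsoPresentation.

Lemma corresponds_presentation (M : monad) (X : theory)
    (cb : const_bin_signature X) :
  corresponds_to M X -> const_is_unit cb -> closed_stable X ->
  variable_stable X -> exists u b, @unital_presentation M u b.
Proof.
move=> [theta iso] unitX closedX varX.
have [g0 _ g0K] := iso_bij iso void; have [g1 _ g1K] := iso_bij iso bool.
exists (g0 (free_unit cb)), (g1 (free_op cb)).
apply: (iso_presentation iso); rewrite g0K g1K.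
exact: free_presentation.
Qed.

(** * Algebras induced by a distributive law *)

Section DistributiveLaw.
Variables (S T : monad) (lam : forall A : Type, S (T A) -> T (S A)).
Hypothesis L : distributive_law lam.

(* The [S]-algebra structure that [lam] induces on [T (S B)]. *)
Definition alg B (m : S (T (S B))) : T (S B) := fmap (join S) (lam m).

(** The inserted units pass through [lam] by naturality and are cancelled by [join S]; hence [alg]
    determines [lam]. *)
Lemma lam_alg A (m : S (T A)) : lam m = alg (fmap (fmap (ret S)) m).
Proof.
rewrite /alg (dist_nat L) -fmap_comp -[LHS]fmap_id; congr fmap.
by apply: funext => s; rewrite /= join_fmap_ret.
Qed.

(** Together with [alg_join], the Eilenberg-Moore laws of [alg]. *)
Lemma alg_ret B (p : T (S B)) : alg (ret S p) = p.
Proof.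
rewrite /alg (dist_retl L) -fmap_comp -[RHS]fmap_id; congr fmap.
by apply: funext => s; rewrite /= join_ret.
Qed.

Lemma alg_join B (m : S (S (T (S B)))) :
  alg (join S m) = alg (fmap (@alg B) m).
Proof.
have -> : fmap (@alg B) m = fmap (fmap (join S)) (fmap (@lam _) m).
  by rewrite -fmap_comp.
rewrite /alg (dist_joinl L) (dist_nat L) -!fmap_comp.
by congr fmap; apply: funext => s; rewrite /= join_join.
Qed.

Lemma alg_nat A B (f : A -> S B) (m : S (T (S A))) :
  alg (fmap (fmap (bind f)) m) = fmap (bind f) (alg m).
Proof.
rewrite /alg (dist_nat L) -!fmap_comp; congr fmap; apply: funext => s.
by rewrite /= !join_bind bind_bind bind_fmap.
Qed.

Lemma alg_pure B (s : S (S B)) : alg (fmap (ret T) s) = ret T (join S s).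
Proof. by rewrite /alg (dist_retr L) ret_nat. Qed.

(** Compatibility of [lam] with [join T]. It reduces products of arbitrary elements to products of
    generators: multiply with the elements of [A] as variables, then replace each [a] by [g a] in
    the resulting elements of [S A] and evaluate these with [alg]. *)
Lemma alg_bind A B (g : A -> T (S B)) (m : S (T A)) :
  alg (fmap (bind g) m) = bind (@alg B \o fmap g) (alg (fmap (fmap (ret S)) m)).
Proof.
have -> : fmap (bind g) m = fmap (join T) (fmap (fmap g) m).
  by rewrite -fmap_comp.
rewrite -lam_alg /alg (dist_joinr L) (dist_nat L) -fmap_comp.
by rewrite -[join T _]/(bind _ _) fmap_bind.
Qed.

Variables (uS : S void) (bS : S bool) (uT : T void) (bT : T bool).
Hypotheses (PS : unital_presentation uS bS) (PT : unital_presentation uT bT).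

Local Notation eS := (unit uS _).
Local Notation eT := (unit uT _).
Local Infix "*S" := (op bS) (at level 40, left associativity).
Local Infix "+T" := (op bT) (at level 50, left associativity).

Definition mul B (p q : T (S B)) : T (S B) := alg (ret S p *S ret S q).

Local Infix "**" := (@mul _) (at level 40, left associativity).

Lemma op_ret A (m n : S A) : m *S n = join S (ret S m *S ret S n).
Proof. by rewrite join_op !join_ret. Qed.

Lemma alg_op B (m n : S (T (S B))) : alg (m *S n) = alg m ** alg n.
Proof. by rewrite op_ret alg_join fmap_op !ret_nat. Qed.

Lemma alg_unit B : alg (eS : S (T (S B))) = ret T eS.
Proof.
by rewrite -(fmap_unit uS (ret T)) alg_pure join_bind bind_unit.
Qed.

Lemma mul_nat A B (f : A -> S B) (p q : T (S A)) :
  fmap (bind f) (p ** q) = fmap (bind f) p ** fmap (bind f) q.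
Proof. by rewrite /mul -alg_nat fmap_op !ret_nat. Qed.

Lemma mul_ret B (s s' : S B) : ret T s ** ret T s' = ret T (s *S s').
Proof. by rewrite /mul -!(@ret_nat S _ _ (ret T)) -fmap_op alg_pure -op_ret. Qed.

Lemma mul_unitr B (p : T (S B)) : p ** ret T eS = p.
Proof. by rewrite -alg_unit -{1}(alg_ret p) -alg_op (op_unitr PS) alg_ret. Qed.

Lemma mul_bind A B (g : A -> T (S B)) (a a' : T A) :
  bind g a ** bind g a' =
  bind (@alg B \o fmap g) (fmap (ret S) a ** fmap (ret S) a').
Proof.
by have := alg_bind g (ret S a *S ret S a'); rewrite !fmap_op !ret_nat.
Qed.

Lemma unit_mul B (q : T (S B)) : eT ** q = eT.
Proof.
(* Generic case, with one variable [tt] in place of [q]: setting it to the unit of [S] gives [eT],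
   and [fmap_eq_unit] lifts this back. *)
have e : (eT : T (S Datatypes.unit)) ** ret T (ret S tt) = eT.
  apply: (fmap_eq_unit PT (f := bind (fun=> eS : S Datatypes.unit))).
  by rewrite mul_nat fmap_unit ret_nat bind_ret mul_unitr.
have := mul_bind (fun=> q) (unit uT Datatypes.unit) (ret T tt).
by rewrite fmap_unit ret_nat e !bind_unit bind_ret.
Qed.

(** A substitution sees only the leaves of [r]. This allows a [g] that sends a variable absent from
    [r] to [eT]. *)
Lemma alg_pure_ev A (g : A -> T (S A)) r :
  (forall a, leaf_of a r -> g a = ret T (ret S a)) ->
  alg (fmap g (ev uS bS r)) = ret T (ev uS bS r).
Proof.
move=> gr; rewrite -bind_ret_comp.
rewrite (eq_bind_ev _ _ (g := ret S \o (ret T \o ret S))); last first.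
  by move=> a ra /=; rewrite gr.
by rewrite bind_ret_comp fmap_comp alg_pure join_fmap_ret.
Qed.

(** * The product of a generic sum with a variable *)

Section Generic.

Let x : option bool := Some true.
Let y : option bool := Some false.
Let z : option bool := None.

Definition generic_product : T (S (option bool)) :=
  (ret T (ret S x) +T ret T (ret S y)) ** ret T (ret S z).

(** Valued in terms rather than in [S], so that [leaf_of_subst] can trace the leaves that
    survive. *)
Definition erase_z (a : option bool) : magma_term (option bool) :=
  if a is Some _ then Leaf a else Unit.

Let f := @ev _ uS bS _ \o erase_z.

Lemma bind_generic_product B (g : option bool -> T (S B)) :
  bind (@alg B \o fmap g) generic_product = (g x +T g y) ** g z.
Proof.
have := mul_bind g (ret T x +T ret T y) (ret T z).
by rewrite fmap_op !ret_nat bind_op !bind_ret.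
Qed.

Lemma erase_generic_product :
  fmap (bind f) generic_product = ret T (ret S x) +T ret T (ret S y).
Proof. by rewrite mul_nat fmap_op !ret_nat !bind_ret mul_unitr. Qed.

Variable W : magma_term (S (option bool)).
Hypothesis WE : generic_product = ev uT bT W.

Lemma erase_leaf s : leaf_of s W -> exists c, bind f s = ret S (Some c).
Proof.
move=> Ws; have [fx|fx] := pselect (bind f s = ret S x); first by exists true.
exists false.
(* [k] kills [x], turning the erased sum [x + y] into [y]. A leaf whose erasure is not [x] survives
   [k] as a variable, which must then be [y]. *)
pose k t : T (S (option bool)) := if `[< t = ret S x >] then eT else ret T t.
have kxy : bind (k \o bind f) (ev uT bT W) = ret T (ret S y).
  rewrite -WE -bind_fmap erase_generic_product bind_op !bind_ret /k asboolT //.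
  by rewrite (op_unitl PT) asboolF // => e; have := ret_inj PS e.
by apply: (bind_eq_ret PT kxy Ws); rewrite /= /k asboolF.
Qed.

Lemma leaf_generic_product s c :
  leaf_of s W -> bind f s = ret S (Some c) ->
  s = ret S (Some c) *S ret S z.
Proof.
have [r ->] := ev_surj PS s; move=> Ws.
rewrite -ev_subst => e; have rc := ev_var PS e => {e}.
(* [g] kills the summand other than [Some c], so that the generic product becomes a single variable
   of [T]. *)
pose g a : T (S (option bool)) :=
  if a == Some (~~ c) then eT else ret T (ret S a).
have gc : bind (@alg _ \o fmap g) (ev uT bT W) =
    ret T (ret S (Some c) *S ret S z).
  rewrite -WE bind_generic_product -mul_ret /g.
  by case: c {rc g}; rewrite /= ?(op_unitl PT) ?(op_unitr PT).
(* The killed generator is not [z], so an occurrence in [r] would survive the erasure, in a term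
   equal to [Some c]. Hence [g] leaves [s] unchanged. *)
apply: (bind_eq_ret PT gc Ws); apply: alg_pure_ev => a ra.
rewrite /g; case: eqP => // ea; suff : Some (~~ c) = Some c by case: (c).
by apply: rc; apply/leaf_of_subst; exists a => //; rewrite ea.
Qed.

Lemma generic_productE :
  generic_product =
  ret T (ret S x *S ret S z) +T ret T (ret S y *S ret S z).
Proof.
(* Erasing [z] and then multiplying by [z] restores every leaf of [W], so the generic product is
   rebuilt from its known erasure. *)
have -> : generic_product =
    fmap (fun s => s *S ret S z) (fmap (bind f) generic_product).
  rewrite -fmap_comp -bind_ret_comp -[LHS]fmap_id -bind_ret_comp WE.
  apply: eq_bind_ev => s Ws /=; congr ret.
  by have [c fc] := erase_leaf Ws; rewrite fc; exact: leaf_generic_product.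
by rewrite erase_generic_product fmap_op !ret_nat.
Qed.

End Generic.

Lemma mulDl B (p q r : T (S B)) : (p +T q) ** r = p ** r +T q ** r.
Proof.
(* Specialising [x], [y], [z] to [p], [q], [r] turns [alg] of a product of two generators into [mul]
   by definition. *)
pose g a := match a with Some true => p | Some false => q | None => r end.
have [W WE] := ev_surj PT generic_product.
rewrite -(bind_generic_product g) (generic_productE WE) bind_op !bind_ret /=.
by rewrite !fmap_op !ret_nat.
Qed.

End DistributiveLaw.

(** * Uniqueness of the product, of the algebra and of the law *)

Section Uniqueness.
Variables (S T : monad).
Variables (uS : S void) (bS : S bool) (uT : T void) (bT : T bool).
Hypotheses (PS : unital_presentation uS bS) (PT : unital_presentation uT bT).

Lemma mul_opposite (lam : forall A, S (T A) -> T (S A)) B (p q : T (S B)) :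
  mul lam (fmap negb bS) p q = mul lam bS q p.
Proof. by rewrite /mul op_opposite. Qed.

Section BothSides.
Variable lam : forall A : Type, S (T A) -> T (S A).
Hypothesis L : distributive_law lam.

Lemma mul_unit B (p : T (S B)) : mul lam bS p (unit uT _) = unit uT _.
Proof.
by have := unit_mul L (opposite_presentation PS) PT p; rewrite mul_opposite.
Qed.

Lemma mulDr B (p q r : T (S B)) :
  mul lam bS r (op bT p q) = op bT (mul lam bS r p) (mul lam bS r q).
Proof.
by have := mulDl L (opposite_presentation PS) PT p q r; rewrite !mul_opposite.
Qed.

End BothSides.

Variables lam1 lam2 : forall A : Type, S (T A) -> T (S A).
Hypotheses (L1 : distributive_law lam1) (L2 : distributive_law lam2).

(** Distributivity and absorption by the constant of [T] reduce both factors to variables of [T],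
    whose product is computed in [S] independently of the law. *)
Lemma mul_unique B (p q : T (S B)) : mul lam1 bS p q = mul lam2 bS p q.
Proof.
elim/(magma_ind PT): p => [s||p p' IHp IHp'].
- elim/(magma_ind PT): q => [s'||q q' IHq IHq'].
  + by rewrite (mul_ret L1) (mul_ret L2).
  + by rewrite (mul_unit L1) (mul_unit L2).
  + by rewrite (mulDr L1) (mulDr L2) IHq IHq'.
- by rewrite (unit_mul L1 PS PT) (unit_mul L2 PS PT).
- by rewrite (mulDl L1 PS PT) (mulDl L2 PS PT) IHp IHp'.
Qed.

(** The algebra laws and [dist_retr] fix [alg] on variables and on the constant; on products it is
    fixed by [mul_unique]. *)
Lemma alg_unique B (m : S (T (S B))) : alg lam1 m = alg lam2 m.
Proof.
elim/(magma_ind PS): m => [p||m n IHm IHn].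
- by rewrite (alg_ret L1) (alg_ret L2).
- by rewrite (alg_unit L1) (alg_unit L2).
- by rewrite (alg_op L1) (alg_op L2) IHm IHn mul_unique.
Qed.

Lemma distributive_law_unique : lam1 = lam2.
Proof.
apply: functional_extensionality_dep => A; apply: funext => m.
by rewrite (lam_alg L1) (lam_alg L2) alg_unique.
Qed.

End Uniqueness.

Theorem corollary4p14 (S T : monad) (SS TT : theory)
  (S_SS : corresponds_to S SS) (T_TT : corresponds_to T TT)
  (cbS : const_bin_signature SS) (cbT : const_bin_signature TT)
  (unitS : const_is_unit cbS) (unitT : const_is_unit cbT)
  (closedS : closed_stable SS) (closedT : closed_stable TT)
  (varS : variable_stable SS) (varT : variable_stable TT)
  (lam1 lam2 : forall A : Type, S (T A) -> T (S A)) :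
  distributive_law lam1 -> distributive_law lam2 -> lam1 = lam2.
Proof.
have [uS [bS PS]] := corresponds_presentation S_SS unitS closedS varS.
have [uT [bT PT]] := corresponds_presentation T_TT unitT closedT varT.
exact: distributive_law_unique PS PT lam1 lam2.
Qed.
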